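(* Let $G=(V,E)$ be a finite undirected graph with nonnegative edge weights, let $\lambda(G)$ be the weight of a global minimum cut of $G$, and let $\rho\ge 1$. Let $A_\rho(G)$ be the set of all cuts $X$ (i.e. sets $\emptyset\neq X\subsetneq V$, with $X$ and $V\setminus X$ regarded as the same cut) satisfying $w(X)\le \rho\,\lambda(G)$. Suppose $X,Y\in A_\rho(G)$ cross each other, i.e. $X\cap Y\neq\emptyset$, $X\setminus Y\neq\emptyset$, $Y\setminus X\neq\emptyset$ and $V\setminus (X\cup Y)\neq\emptyset$. Then at least two of the four cuts $Z_1=X\cap Y$, $Z_2=X\setminus Y$, $Z_3=Y\setminus X$, $Z_4=V\setminus(X\cup Y)$ belong to $A_\rho(G)$.
   Context: A cut of $G$ is given by a vertex set $\emptyset\neq X\subsetneq V$; its weight $w(X)$ is the sum of the weights of the edges having one endpoint in $X$ and the other in $V\setminus X$. The global minimum cut weight $\lambda(G)$ is the minimum of $w(X)$ over all cuts. A cut $X$ is $\rho$-approximate if $w(X)\le\rho\lambda(G)$, and $A_\rho(G)$ (the $\rho$-approximation set) is the set of all $\rho$-approximate cuts. The cuts $Z_1,Z_2,Z_3,Z_4$ are called the composed cuts of $X$ and $Y$. *)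

(* Defs.v *)
From HB Require Import structures.
From mathcomp Require Import all_boot all_order all_algebra.

Set Implicit Arguments.
Unset Strict Implicit.
Unset Printing Implicit Defensive.

Import Order.TTheory GRing.Theory Num.Theory.
Local Open Scope ring_scope.

(* Edges are abstract labels with an unordered pair of endpoints, so that
   parallel edges and loops are allowed; simple graphs are the case where [ends]
   is injective with values of cardinality 2. *)
Record wgraph (R : numDomainType) (V : finType) := WGraph {
  edge : finType;
  ends : edge -> {set V};
  weight : edge -> R;
  endsP : forall e, exists u v, ends e = [set u; v];
  weight_ge0 : forall e, 0 <= weight e }.

Section Cuts.
Context {R : realFieldType} {V : finType}.
Implicit Types (G : wgraph R V) (X Y Z : {set V}) (rho : R).

Definition is_cut X := (X != set0) && (X \proper [set: V]).

Definition crosses_edge G X (e : edge G) :=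
  [exists u in X, exists v in ~: X, ends e == [set u; v]].

Definition cut_weight G X : R := \sum_(e : edge G | crosses_edge X e) weight e.

(* The value 0 is junk, taken only when there is no cut, i.e. #|V| < 2. *)
Definition min_cut_weight G : R :=
  if [pick X | is_cut X] is Some X0
  then cut_weight G [arg min_(X < X0 | is_cut X) cut_weight G X]%O else 0.

(* The cut given by X, as the unordered bipartition {X, V \ X}: the vertex sets
   X and V \ X give the same cut. *)
Definition cut_of X : {set {set V}} := [set X; ~: X].

Definition approx_cuts G rho : {set {set {set V}}} :=
  [set cut_of X | X in [set X : {set V} | is_cut X &
     cut_weight G X <= rho * min_cut_weight G]].

Definition crossing X Y :=
  [&& X :&: Y != set0, X :\: Y != set0, Y :\: X != set0 & ~: (X :|: Y) != set0].

Definition composed_cuts X Y : {set {set {set V}}} :=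
  [set cut_of (X :&: Y); cut_of (X :\: Y); cut_of (Y :\: X);
       cut_of (~: (X :|: Y))].

Lemma min_cut_weightP G X0 : is_cut X0 ->
  (exists2 X, is_cut X & min_cut_weight G = cut_weight G X) /\
  (forall X, is_cut X -> min_cut_weight G <= cut_weight G X).
Proof.
rewrite /min_cut_weight => cX0; case: pickP => [X1 cX1 | /(_ X0)]; last by rewrite cX0.
by case: arg_minP => // X cX minX; split=> //; exists X.
Qed.

Lemma is_cutC X : is_cut (~: X) = is_cut X.
Proof.
by rewrite /is_cut !properT andbC -!(inj_eq (@setC_inj V) (~: X)) setCK setCT setC0.
Qed.

Lemma cut_weightC G X : cut_weight G (~: X) = cut_weight G X.
Proof.
apply: eq_bigl => e; rewrite /crosses_edge setCK.
by apply/exists_inP/exists_inP => -[u uX /exists_inP[v vX E]];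
  exists v => //; apply/exists_inP; exists u; rewrite // setUC.
Qed.

(* Membership does not depend on the side chosen to represent the cut. *)
Lemma cut_of_approx G rho X : (cut_of X \in approx_cuts G rho) =
  is_cut X && (cut_weight G X <= rho * min_cut_weight G).
Proof.
apply/imsetP/idP => [[Y] | XA]; last by exists X; rewrite // inE.
rewrite inE => YA /setP/(_ X); rewrite !inE eqxx /= => /esym/orP[]/eqP-> //.
by rewrite is_cutC cut_weightC.
Qed.

End Cuts.

(* Main.v *)
(** The cut function is submodular, so [w Z1 + w Z4] and [w Z2 + w Z3] are both
    at most [w X + w Y <= 2 * rho * lambda] (the second sum is the first one with
    [Y] replaced by its complement).  Hence each of the pairs [{Z1, Z4}] and
    [{Z2, Z3}] contains a [rho]-approximate cut, and since the four corners are
    nonempty, corners from different pairs are neither equal nor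
    complementary. *)
Require Import Defs.
From mathcomp Require Import all_boot all_order all_algebra.
From mathcomp Require Import lra.

Import Order.TTheory GRing.Theory Num.Theory.
Local Open Scope ring_scope.

(** Frees [crosses_edge] from the choice and order of endpoints, so that comparing cut weights
    becomes a Boolean check on each edge; a loop never crosses. *)
Lemma crosses_edgeE {R : realFieldType} {V : finType} {G : wgraph R V}
    {X : {set V}} {e : edge G} {u v : V} :
  ends e = [set u; v] -> crosses_edge X e = (u \in X) (+) (v \in X).
Proof.
move=> euv; apply/exists_inP/idP => [[a aX /exists_inP[b]] | ].
  rewrite inE euv => bX /eqP E.
  have: u \in [set a; b] by rewrite -E set21.
  have: v \in [set a; b] by rewrite -E set22.
  have: a \in [set u; v] by rewrite E set21.
  have: b \in [set u; v] by rewrite E set22.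
  (* The two degenerate cases [u = v = a] and [u = v = b] force [a = b], although only [a] lies in
     [X]. *)
  rewrite !inE => bE aE /orP[]/eqP vE /orP[]/eqP uE; move: aE bE;
    rewrite uE vE ?aX ?(negbTE bX) // orbb.
    by move=> _; rewrite orbb => /eqP ba; rewrite ba aX in bX.
  by move=> /eqP ab; rewrite -ab aX in bX.
case uX: (u \in X); case vX: (v \in X) => // _.
- by exists u => //; apply/exists_inP; exists v; rewrite ?inE ?vX ?euv.
- by exists v => //; apply/exists_inP; exists u; rewrite ?inE ?uX ?euv 1?setUC.
Qed.

(** Holds edge by edge, over the sixteen positions of the endpoints. Both sides count an edge
    equally often, except one between [X :\: Y] and [Y :\: X]: it counts twice on the right only,
    and there nonnegativity of the weight is used. *)
Lemma cut_weight_submodular {R : realFieldType} {V : finType} (G : wgraph R V)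
    (X Y : {set V}) :
  cut_weight G (X :&: Y) + cut_weight G (X :|: Y)
    <= cut_weight G X + cut_weight G Y.
Proof.
rewrite /cut_weight !(big_mkcond (crosses_edge _)) -!big_split /=.
apply: ler_sum => e _; have [u [v euv]] := endsP e.
have := weight_ge0 e; rewrite !(crosses_edgeE euv) !inE.
by case: (u \in X); case: (u \in Y); case: (v \in X); case: (v \in Y) => /=; lra.
Qed.

Lemma cut_weight_uncross {R : realFieldType} {V : finType} {G : wgraph R V}
    {t : R} {X Y : {set V}} :
  cut_weight G X <= t -> cut_weight G Y <= t ->
  cut_weight G (X :&: Y) <= t \/ cut_weight G (~: (X :|: Y)) <= t.
Proof.
move=> Xt Yt; rewrite cut_weightC.
have := cut_weight_submodular G X Y.
by case: (lerP (cut_weight G (X :&: Y)) t) => ?; [left | right; lra].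
Qed.

Lemma is_cut_witness {V : finType} {A : {set V}} {a b : V} :
  a \in A -> b \notin A -> is_cut A.
Proof.
move=> aA bA; rewrite /is_cut properT; apply/andP; split.
  by apply/set0Pn; exists a.
by apply: contraNneq bA => ->; rewrite inE.
Qed.

(** The vertex [a] excludes [A = B], and [c], lying outside both sets, excludes [A = ~: B]. *)
Lemma cut_of_neq {V : finType} {A B : {set V}} {a c : V} :
  a \in A -> a \notin B -> c \notin A -> c \notin B -> cut_of A != cut_of B.
Proof.
move=> aA aB cA cB; apply/eqP => /setP/(_ A).
rewrite !inE eqxx /= => /esym/orP[]/eqP E.
  by rewrite -E aA in aB.
by rewrite E inE cB in cA.
Qed.

Theorem theorem1 (R : realFieldType) (V : finType) (G : wgraph R V) (rho : R)
    (rho_ge1 : 1 <= rho) (X Y : {set V})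
    (XA : cut_of X \in approx_cuts G rho)
    (YA : cut_of Y \in approx_cuts G rho)
    (XY : crossing X Y) :
  (2 <= #|composed_cuts X Y :&: approx_cuts G rho|)%N.
Proof.
move: XA YA; rewrite !cut_of_approx => /andP[_ wX] /andP[_ wY].
case/and4P: XY => /set0Pn[z1 +] /set0Pn[z2 +] /set0Pn[z3 +] /set0Pn[z4 +].
rewrite !inE negb_or => /andP[z1X z1Y] /andP[/negbTE z2Y z2X].
move=> /andP[/negbTE z3X z3Y] /andP[/negbTE z4X /negbTE z4Y].
pose zE := (inE, z1X, z1Y, z2X, z2Y, z3X, z3Y, z4X, z4Y).
have w14 := cut_weight_uncross wX wY.
have w23 : cut_weight G (X :\: Y) <= rho * min_cut_weight G \/
           cut_weight G (Y :\: X) <= rho * min_cut_weight G.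
  have wYC : cut_weight G (~: Y) <= rho * min_cut_weight G by rewrite cut_weightC.
  have := cut_weight_uncross wX wYC.
  by rewrite setCU setCK -setDE [~: X :&: Y]setIC -setDE.
have corners A B a b c : cut_weight G A <= rho * min_cut_weight G ->
    cut_weight G B <= rho * min_cut_weight G ->
    cut_of A \in composed_cuts X Y -> cut_of B \in composed_cuts X Y ->
    a \in A -> a \notin B -> b \in B -> c \notin A -> c \notin B ->
    (2 <= #|composed_cuts X Y :&: approx_cuts G rho|)%N.
  move=> wA wB AC BC aA aB bB cA cB; apply/card_gt1P.
  exists (cut_of A), (cut_of B); split; last exact: cut_of_neq aA aB cA cB.
    by rewrite inE AC cut_of_approx wA (is_cut_witness aA cA).
  by rewrite inE BC cut_of_approx wB (is_cut_witness bB cB).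
case: w14 => w1; case: w23 => w2.
(* In each case the third vertex, outside both chosen corners, comes from the unchosen one of
   [X :\: Y] and [Y :\: X]. *)
- by apply: (corners _ _ z1 z2 z3 w1 w2); rewrite !zE ?eqxx ?orbT.
- by apply: (corners _ _ z1 z3 z2 w1 w2); rewrite !zE ?eqxx ?orbT.
- by apply: (corners _ _ z4 z2 z3 w1 w2); rewrite !zE ?eqxx ?orbT.
- by apply: (corners _ _ z4 z3 z2 w1 w2); rewrite !zE ?eqxx ?orbT.
Qed.
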